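(* Let $F$ be a field, $L\ge 1$ an integer, and for $i=1,\ldots,L$ let $b^{(i)}(x),m^{(i)}(x)\in F[x]$ with $\deg m^{(i)}(x)\ge 1$ and $\deg b^{(i)}(x)<\deg m^{(i)}(x)$, and let $\tau^{(i)}\in\mathbb{Z}$ with $0\le\tau^{(i)}\le\deg m^{(i)}(x)$. If $\Lambda(x)$ solves the associated simultaneous partial-inverse (SPI) problem, then $$\deg\Lambda(x)\le\sum_{i=1}^{L}\big(\deg m^{(i)}(x)-\tau^{(i)}\big).$$
   Context: Here $a(x)\bmod m(x)$ denotes the remainder of the division of $a(x)$ by $m(x)$. The degree of the zero polynomial is $-\infty$. SPI problem: given $b^{(i)}(x),m^{(i)}(x),\tau^{(i)}$ for $i=1,\ldots,L$ as in the claim, find a nonzero polynomial $\Lambda(x)\in F[x]$ of the smallest degree such that $\deg\big(b^{(i)}(x)\Lambda(x)\bmod m^{(i)}(x)\big)<\tau^{(i)}$ for all $i\in\{1,\ldots,L\}$; such a polynomial is called a solution. *)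

(* Defs.v *)
From HB Require Import structures.
From mathcomp Require Import all_boot all_order all_algebra.

Set Implicit Arguments.
Unset Strict Implicit.
Unset Printing Implicit Defensive.

Import GRing.Theory.
Local Open Scope ring_scope.

(* Since [size p] is [deg p + 1], and 0 for [p = 0] (where the degree is -oo),
   [size p <= t] is [deg p < t] for every natural number [t], and comparing
   sizes is comparing degrees; in particular [t = 0] forces [p = 0]. *)
Definition spi_feasible (F : fieldType) (L : nat)
    (b m : 'I_L -> {poly F}) (tau : 'I_L -> nat) (Lambda : {poly F}) : Prop :=
  Lambda != 0 /\
  forall i : 'I_L, (size ((b i * Lambda) %% m i)%R <= tau i)%N.

Definition spi_solution (F : fieldType) (L : nat)
    (b m : 'I_L -> {poly F}) (tau : 'I_L -> nat) (Lambda : {poly F}) : Prop :=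
  spi_feasible b m tau Lambda /\
  forall Lambda' : {poly F},
    spi_feasible b m tau Lambda' -> (size Lambda <= size Lambda')%N.

(* Main.v *)
Require Import Defs.
From HB Require Import structures.
From mathcomp Require Import all_boot all_order all_algebra.
Import GRing.Theory.
Local Open Scope ring_scope.

(* The condition deg (b Lambda mod m) < tau says that the coefficients of
   b Lambda mod m in degrees tau, ..., deg m - 1 vanish; these are deg m - tau
   linear conditions on Lambda.  With N such conditions in total, the space of
   polynomials of degree at most N, of dimension N + 1, contains a nonzero
   feasible polynomial, and a solution has at most its degree. *)

(** The values of the forms on the monomials of degree at most [#|T|] fill a matrix with one more
    row than columns; a nonzero row vector in its left kernel lists the coefficients of [p]. *)
Lemma ex_poly_scalar_eq0 (F : fieldType) (T : finType)
    (f : T -> {scalar {poly F}}) :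
  exists p : {poly F},
    [/\ p != 0, (size p <= #|T|.+1)%N & forall t, f t p = 0].
Proof.
pose A := \matrix_(i < #|T|.+1, j < #|T|) f (enum_val j) 'X^i.
have kerA_neq0 : nz_row (kermx A) != 0.
  by rewrite nz_row_eq0 -mxrank_eq0 mxrank_ker subn_eq0 -ltnNge ltnS rank_leq_col.
exists (rVpoly (nz_row (kermx A))); split; last 1 first.
- move=> t; have /sub_kermxP/matrixP/(_ 0 (enum_rank t)) := nz_row_sub (kermx A).
  rewrite !mxE => kerAt; rewrite -[RHS]kerAt [X in f t X]poly_def linear_sum.
  apply: eq_bigr => i _; rewrite linearZ /= [A _ _]mxE enum_rankK.
  by rewrite valK.
- apply: contra_neq kerA_neq0 => rVp_eq0.
  by rewrite -[LHS]rVpolyK rVp_eq0 linear0.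
- exact: size_poly.
Qed.

(** Named as a function of [p] so that a linear structure can be attached to it. *)
Definition coef_mulp_mod (F : fieldType) (b m : {poly F}) (k : nat)
  (p : {poly F}) : F := ((b * p) %% m)`_k.

Lemma coef_mulp_mod_is_scalar (F : fieldType) (b m : {poly F}) (k : nat) :
  scalar (coef_mulp_mod F b m k).
Proof.
by move=> a p q; rewrite /coef_mulp_mod mulrDr -scalerAr modpD modpZl coefD coefZ.
Qed.

HB.instance Definition _ (F : fieldType) (b m : {poly F}) (k : nat) :=
  GRing.isLinear.Build F {poly F} F *%R (coef_mulp_mod F b m k)
    (coef_mulp_mod_is_scalar F b m k).

Lemma ex_spi_feasible (F : fieldType) (L : nat)
    (b m : 'I_L -> {poly F}) (tau : 'I_L -> nat)
    (m_neq0 : forall i : 'I_L, m i != 0) :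
  exists2 p : {poly F}, spi_feasible b m tau p
    & (size p <= (\sum_(i < L) ((size (m i)).-1 - tau i)).+1)%N.
Proof.
(* One index per linear condition: the pair of [i] and [j] stands for the coefficient of degree
   [tau i + j]. *)
pose T := {i : 'I_L & 'I_((size (m i)).-1 - tau i)}.
pose f (t : T) : {scalar {poly F}} :=
  coef_mulp_mod F (b (tag t)) (m (tag t)) (tau (tag t) + tagged t).
have [p [p_neq0 size_p fp0]] := ex_poly_scalar_eq0 F T f.
have cardT : #|{: T}| = (\sum_(i < L) ((size (m i)).-1 - tau i))%N.
  rewrite card_tagged sumnE big_map big_enum /=.
  by apply: eq_bigr => i _; rewrite card_ord.
exists p; last by rewrite -cardT.
split=> // i; apply/leq_sizeP => k tau_le_k.
(* From the degree of [m i] on, the coefficients of a remainder vanish anyway; below it, [k] is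
   [tau i + j] with [j = k - tau i], one of the imposed conditions. *)
have [m_le_k | k_lt_m] := leqP (size (m i)).-1 k.
  apply: nth_default; apply: leq_trans m_le_k.
  by rewrite -ltnS (ltn_predK (m := 0)) ?size_poly_gt0 // ltn_modp.
have j_lt : (k - tau i < (size (m i)).-1 - tau i)%N.
  by rewrite ltn_sub2r ?(leq_ltn_trans tau_le_k).
have := fp0 (Tagged (fun i => 'I_((size (m i)).-1 - tau i)) (Ordinal j_lt)).
by rewrite /f /= /coef_mulp_mod subnKC.
Qed.

Theorem proposition3 (F : fieldType) (L : nat) (hL : (1 <= L)%N)
    (b m : 'I_L -> {poly F}) (tau : 'I_L -> nat)
    (hm : forall i : 'I_L, (1 <= (size (m i)).-1)%N)
    (hb : forall i : 'I_L, (size (b i) < size (m i))%N)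
    (htau : forall i : 'I_L, (tau i <= (size (m i)).-1)%N)
    (Lambda : {poly F}) (hLambda : spi_solution b m tau Lambda) :
  ((size Lambda).-1 <= \sum_(i < L) ((size (m i)).-1 - tau i))%N.
Proof.
have m_neq0 i : m i != 0.
  by apply: contraTneq (hm i) => ->; rewrite size_poly0.
have [p p_feasible size_p] := ex_spi_feasible F L b m tau m_neq0.
have [_ Lambda_min] := hLambda.
by rewrite -subn1 leq_subLR add1n (leq_trans (Lambda_min p p_feasible)).
Qed.
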